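(* For the inexact SQA algorithm described in the context, the stepsize $\alpha_k$ exists for each of the line searches LS1, LS2, LS3, LS4: that is, for every $k\ge0$, every current iterate $x_k\in\operatorname{dom}F$ and every $\bar x_{k+1}$ satisfying the inexactness condition, the set of $\alpha\in\{\bar\alpha\beta^i:i=0,1,2,\dots\}$ satisfying the line search inequality is nonempty, so that its maximum $\alpha_k>0$ exists.
   Context: Setting. $\mathcal{H}$ is a real Hilbert space with norm $\|\cdot\|$ and inner product $\langle\cdot,\cdot\rangle$. $F:=f+g$, where $f,g:\mathcal{H}\to(-\infty,\infty]$ are proper lower semicontinuous convex functions with $\operatorname{dom} g\subset\operatorname{int}(\operatorname{dom} f)$ (so $\operatorname{dom}F=\operatorname{dom}g$). $f$ is Fréchet differentiable on an open set containing $\operatorname{dom} g$, and $\nabla f$ is continuous on $\operatorname{dom} g$. The set $\mathcal{X}$ of minimizers of $F$ is nonempty and $F^\ast:=\min F\in\mathbb{R}$. Metrics. $H_k:\mathcal{H}\to\mathcal{H}$ ($k\ge0$) are positive self-adjoint operators, $\langle\cdot,\cdot\rangle_k=\langle\cdot,H_k\cdot\rangle$ are inner products with induced norms $\|\cdot\|_k$, and there are constants $m,M>0$ with $m\|\cdot\|^2\le\|\cdot\|_k^2\le M\|\cdot\|^2$ for all $k\ge0$. Algorithm (inexact SQA). Fix $\eta\in(0,1]$, $x_0\in\operatorname{dom}F$, and one of the line searches below. For $k=0,1,2,\dots$, let $Q_k(x):=\langle\nabla f(x_k),x-x_k\rangle+g(x)-g(x_k)+\frac12\|x-x_k\|_k^2$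 and $Q_k^\ast:=\min_{x\in\mathcal{H}}Q_k(x)$. Choose any $\bar x_{k+1}$ satisfying the inexactness condition $Q_k(\bar x_{k+1})\le\eta\,(Q_k^\ast-Q_k(x_k))$ (note $Q_k(x_k)=0$), put $d_k:=\bar x_{k+1}-x_k$, determine $\alpha_k$ by the line search, and set $x_{k+1}:=x_k+\alpha_k d_k$. Line searches. In each case $\beta\in(0,1)$, $\bar\alpha\in(0,1]$, and $\alpha_k$ is the largest $\alpha\in\{\bar\alpha\beta^i: i=0,1,2,\dots\}$ satisfying: LS1 ($\gamma\in(0,1)$): $F(x_k+\alpha d_k)-F(x_k)\le\gamma\alpha\big(\langle\nabla f(x_k),d_k\rangle+g(\bar x_{k+1})-g(x_k)\big)$. LS2 ($\gamma\in(0,m/2)$): $\alpha\|\nabla f(x_k+\alpha d_k)-\nabla f(x_k)\|\le\gamma\|\alpha d_k\|$. LS3 ($\gamma\in(0,1)$): $F(x_k+\alpha d_k)-F(x_k)\le\alpha\big(\langle\nabla f(x_k),d_k\rangle+g(\bar x_{k+1})-g(x_k)+\frac{\gamma}{2}\|d_k\|_k^2\big)$. LS4 ($\gamma\in(0,1)$): $f(x_k+\alpha d_k)-f(x_k)\le\alpha\big(\langle\nabla f(x_k),d_k\rangle+\frac{\gamma}{2}\|d_k\|_k^2\big)$. *)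

(* Defs.v *)
From HB Require Import structures.
From mathcomp Require Import all_boot all_order all_algebra.
From mathcomp Require Import sesquilinear.
From mathcomp Require Import all_classical all_reals all_analysis.

Set Implicit Arguments.
Unset Strict Implicit.
Unset Printing Implicit Defensive.

Import Order.TTheory GRing.Theory Num.Theory.
Import numFieldNormedType.Exports.

Local Open Scope classical_set_scope.
Local Open Scope ring_scope.
Local Open Scope ereal_scope.

(* With H a completeNormedModType, this makes (H, ip) a real Hilbert space:
   {dot H for idfun} is a symmetric positive definite bilinear form. *)
Definition hilbert_norm (R : realType) (H : completeNormedModType R)
    (ip : {dot H for idfun}) : Prop :=
  forall x : H, (`|x| ^+ 2 = ip x x)%R.

Section ExtendedRealFunctions.
Variables (R : realType) (H : completeNormedModType R).
Implicit Types f : H -> \bar R.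

Definition domain f : set H := [set x | f x < +oo].

Definition proper f : Prop := (forall x, f x != -oo) /\ domain f !=set0.

(* The endpoint values of t are harmless: 0 * +oo = 0 in \bar R. *)
Definition convex f : Prop :=
  forall (x y : H) (t : R), (0 <= t <= 1)%R ->
    f (t *: x + (1 - t) *: y)%R <= t%:E * f x + (1 - t)%:E * f y.

Definition proper_lsc_convex f : Prop :=
  [/\ proper f, lower_semicontinuous f & convex f].

Definition minimizers f : set H := [set x | forall y, f x <= f y].

(* v is the gradient at x of f, Frechet differentiable at x; f has to be finite
   around x because fine sends +oo to 0. *)
Definition has_gradient (ip : {dot H for idfun}) f (x v : H) : Prop :=
  [/\ \forall y \near x, f y \is a fin_num,
      differentiable (fine \o f : H -> R^o) x &
      forall h : H, 'd (fine \o f : H -> R^o) x h = ip v h].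

End ExtendedRealFunctions.

Section Metrics.
Variables (R : realType) (H : completeNormedModType R).
Variables (ip : {dot H for idfun}).

Definition self_adjoint (A : H -> H) : Prop :=
  forall x y : H, ip (A x) y = ip x (A y).

Definition positive (A : H -> H) : Prop :=
  forall x : H, x != 0%R -> (0 < ip x (A x))%R.

Definition metric_norm (A : H -> H) (x : H) : R := Num.sqrt (ip x (A x)).

End Metrics.

Section InexactSQA.
Variables (R : realType) (H : completeNormedModType R).
Variables (ip : {dot H for idfun}) (f g : H -> \bar R) (gradf : H -> H).

Definition objective (x : H) : \bar R := f x + g x.

Definition model (Hk : H -> H) (xk x : H) : \bar R :=
  (ip (gradf xk) (x - xk)%R)%:E + (g x - g xk)
  + (2^-1 * metric_norm ip Hk (x - xk) ^+ 2)%:E.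

(* The model is strongly convex, so that this infimum is attained. *)
Definition model_min (Hk : H -> H) (xk : H) : \bar R :=
  ereal_inf (range (model Hk xk)).

Definition inexact (eta : R) (Hk : H -> H) (xk xbar : H) : Prop :=
  model Hk xk xbar <= eta%:E * (model_min Hk xk - model Hk xk xk).

Definition grid (abar beta : R) : set R :=
  [set a | exists i : nat, a = (abar * beta ^+ i)%R].

Definition LS1 (gamma : R) (xk xbar : H) : set R := [set a |
  let d := (xbar - xk)%R in
  objective (xk + a *: d)%R - objective xk
    <= (gamma * a)%:E * ((ip (gradf xk) d)%:E + (g xbar - g xk))].

Definition LS2 (gamma : R) (xk xbar : H) : set R := [set a |
  let d := (xbar - xk)%R in
  (a * `|gradf (xk + a *: d) - gradf xk| <= gamma * `|a *: d|)%R].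

Definition LS3 (gamma : R) (Hk : H -> H) (xk xbar : H) : set R := [set a |
  let d := (xbar - xk)%R in
  objective (xk + a *: d)%R - objective xk
    <= a%:E * ((ip (gradf xk) d)%:E + (g xbar - g xk)
               + (gamma / 2 * metric_norm ip Hk d ^+ 2)%:E)].

Definition LS4 (gamma : R) (Hk : H -> H) (xk xbar : H) : set R := [set a |
  let d := (xbar - xk)%R in
  f (xk + a *: d)%R - f xk
    <= a%:E * ((ip (gradf xk) d)%:E
               + (gamma / 2 * metric_norm ip Hk d ^+ 2)%:E)].

End InexactSQA.

Definition stepsize_exists (R : realType) (abar beta : R) (LS : set R) : Prop :=
  let S := grid abar beta `&` LS in
  S !=set0 /\ exists alpha : R, [/\ S alpha, ubound S alpha & (0 < alpha)%R].

(* Main.v *)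
Require Import Defs.
From mathcomp Require Import all_boot all_order all_algebra.
From mathcomp Require Import sesquilinear.
From mathcomp Require Import all_classical all_reals all_analysis.
From mathcomp Require Import lra.

Set Implicit Arguments.
Unset Strict Implicit.

Import Order.TTheory GRing.Theory Num.Theory.
Import numFieldNormedType.Exports.

Local Open Scope classical_set_scope.
Local Open Scope ring_scope.

(** Write d for the search direction, q for its squared norm in the current
    metric and D for the linearized decrease, that is, the inner product of the
    gradient with d plus the increment of g. Each line search turns out to
    accept every sufficiently small positive step, so the geometrically
    decreasing trial steps eventually get accepted ([stepsize_exists_near]).

    Inexactness makes the model nonpositive at the candidate, that is,
    D <= - q / 2 ([inexact_descent]); by the lower bound on the metrics, q > 0
    unless d = 0. Frechet differentiability of f bounds its increment along d,
    for small steps a, by a times the directional derivative plus any prescribed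
    slack e > 0 ([gradient_upper_bound]); convexity bounds the increment of g by
    a times its full increment, so that the objective grows by at most a (D + e)
    ([objective_upper_bound]). The four searches differ in the slack only:
    e = (1 - gamma) (- D) gives LS1, since then D + e = gamma D, and
    e = gamma q / 2 gives LS3, and LS4 with f alone. LS2 is the continuity of
    the gradient along the segment, which convexity keeps inside the domain of g.

    When d = 0 there is no positive slack, but every trial point is the current
    iterate and all increments vanish; the lemmas therefore ask for e > 0 only
    when d differs from 0, so that LS1, LS3 and LS4 need no case distinction. *)

(** Since the trial steps decrease geometrically to 0, some of them enter the
    half-neighbourhood; the accepted one with the smallest exponent is the
    maximum. *)
Lemma stepsize_exists_near (R : realType) (abar beta : R) (LS : set R) :
  0 < abar -> 0 < beta < 1 -> (\forall a \near 0^'+, LS a) ->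
  stepsize_exists abar beta LS.
Proof.
move=> abar0 /andP[beta0 beta1] nearLS.
have gt0 i : 0 < abar * beta ^+ i by rewrite mulr_gt0 // exprn_gt0.
have trial_cvg : abar * beta ^+ i @[i --> \oo] --> (0 : R).
  rewrite -(mulr0 abar); apply: cvgMr; apply: cvg_expr.
  by rewrite ger0_norm // ltW.
have exLS : exists i, `[< LS (abar * beta ^+ i) >].
  have [e /= e0 He] := nearLS.
  have /cvgr_dist_lt/(_ e e0) [N _ HN] := trial_cvg.
  exists N; apply/asboolP; apply: He (gt0 N).
  exact: HN (leqnn N).
case: (ex_minnP exLS) => n /asboolP LSn n_min.
have Sn : (grid abar beta `&` LS) (abar * beta ^+ n) by split=> //; exists n.
split; first by exists (abar * beta ^+ n).
exists (abar * beta ^+ n); split=> //.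
move=> _ [[i ->] LSi]; rewrite ler_pM2l //.
by apply: ler_wiXn2l; [exact: ltW|exact: ltW|apply: n_min; apply/asboolP].
Qed.

Lemma domain_fin_num (R : realType) (H : completeNormedModType R)
    (g : H -> \bar R) (x : H) : Defs.proper g -> domain g x -> g x \is a fin_num.
Proof. by move=> [gNoo _] gx; rewrite fin_numE gNoo /= lt_eqF. Qed.

Lemma segmentE (R : realType) (H : completeNormedModType R) (x y : H) (a : R) :
  x + a *: (y - x) = a *: y + (1 - a) *: x.
Proof. by rewrite scalerBr scalerBl scale1r addrCA. Qed.

Lemma convex_increment_le (R : realType) (H : completeNormedModType R)
    (g : H -> \bar R) (x y : H) (a : R) :
  convex g -> g x \is a fin_num -> g y \is a fin_num -> 0 <= a <= 1 ->
  (g (x + a *: (y - x))%R - g x <= a%:E * (g y - g x))%E.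
Proof.
move=> gcvx gx gy a01; rewrite leeBlDr //.
apply: le_trans (_ : _ <= a%:E * g y + (1 - a)%:E * g x)%E _.
  by rewrite segmentE; exact: gcvx.
rewrite -(fineK gx) -(fineK gy) -!EFinB -!EFinM -!EFinD lee_fin; lra.
Qed.

Lemma convex_domain_segment (R : realType) (H : completeNormedModType R)
    (g : H -> \bar R) (x y : H) (a : R) :
  convex g -> g x \is a fin_num -> g y \is a fin_num -> 0 <= a <= 1 ->
  domain g (x + a *: (y - x)).
Proof.
move=> gcvx gx gy a01; rewrite /domain /= segmentE.
apply: le_lt_trans (gcvx y x a a01) _.
by rewrite -(fineK gx) -(fineK gy) -!EFinM -EFinD ltry.
Qed.

Lemma near_unit_steps (R : realType) : \forall a \near (0 : R)^'+, 0 < a <= 1.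
Proof.
near=> a; apply/andP; split; near: a; first exact: nbhs_right_gt.
by apply: nbhs_right_le.
Unshelve. all: by end_near. Qed.

Lemma ray_cvg (R : realType) (H : completeNormedModType R) (x d : H) :
  x + a *: d @[a --> (0 : R)] --> x.
Proof.
rewrite -[X in _ --> X]addr0 -[X in _ --> _ + X](scale0r d).
by apply: cvgD; [exact: cvg_cst|apply: cvgZr_tmp; exact: cvg_id].
Qed.

Lemma ray_near (R : realType) (H : completeNormedModType R) (x d : H)
    (P : set H) :
  (\forall y \near x, P y) -> \forall a \near (0 : R)^'+, P (x + a *: d).
Proof. by move=> nP; have := cvg_at_right_filter (@ray_cvg _ _ x d) nP. Qed.

(** The difference quotient along d tends to the inner product of the gradient
    with d, hence lies below any larger number for small steps. For d = 0 the
    increment vanishes and nonnegative slack suffices. *)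
Lemma gradient_upper_bound (R : realType) (H : completeNormedModType R)
    (ip : {dot H for idfun}) (f : H -> \bar R) (x v d : H) (e : R) :
  has_gradient ip f x v -> 0 <= e -> (d != 0 -> 0 < e) ->
  \forall a \near 0^'+,
    (f (x + a *: d)%R - f x <= a%:E * ((ip v d)%:E + e%:E))%E.
Proof.
move=> [ffin fdiff fgrad] e0 de.
have fx : f x \is a fin_num := nbhs_singleton ffin.
have [->|d0] := eqVneq d 0.
  near=> a; rewrite scaler0 addr0 subee // linear0r add0e -EFinM lee_fin.
  by apply: mulr_ge0 => //; apply: ltW; near: a; exact: nbhs_right_gt.
have /cvg_ex[l lP] : derivable (fine \o f : H -> R^o) x d.
  exact: diff_derivable.
have lE : l = ip v d.
  rewrite -fgrad -deriveE //; apply/esym.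
  exact: (cvg_lim (@Rhausdorff R) lP).
have := cvgr_lt _ (cvg_dnbhs_at_right lP) (ip v d + e).
rewrite lE ltrDl => /(_ _ (de d0)) quotient_lt.
near=> a.
have a0 : 0 < a by near: a; exact: nbhs_right_gt.
have fa : f (x + a *: d) \is a fin_num
  by near: a; exact: (@ray_near _ _ _ _ [set z | f z \is a fin_num]).
have : a^-1 * (fine (f (a *: d + x)) - fine (f x)) < ip v d + e by near: a.
rewrite ltr_pdivrMl // (addrC (a *: d)) => /ltW.
by rewrite -(fineK fx) -(fineK fa) -EFinB -EFinD -EFinM lee_fin.
Unshelve. all: by end_near. Qed.

(** The first-order bound on f adds up with the convexity bound on g: both are
    proportional to the step. *)
Lemma objective_upper_bound (R : realType) (H : completeNormedModType R)
    (ip : {dot H for idfun}) (f g : H -> \bar R) (x y v : H) (e : R) :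
  has_gradient ip f x v -> Defs.proper g -> convex g ->
  domain g x -> domain g y ->
  0 <= e -> (y - x != 0 -> 0 < e) ->
  \forall a \near 0^'+,
    (objective f g (x + a *: (y - x))%R - objective f g x
       <= a%:E * ((ip v (y - x)%R)%:E + (g y - g x) + e%:E))%E.
Proof.
move=> fgrad gpr gcvx gx gy e0 de.
have [ffin _ _] := fgrad.
have fx : f x \is a fin_num := nbhs_singleton ffin.
have {}gx := domain_fin_num gpr gx.
have {}gy := domain_fin_num gpr gy.
near=> a.
have /andP[a0 a1] : 0 < a <= 1 by near: a; exact: near_unit_steps.
have a01 : 0 <= a <= 1 by rewrite ltW.
have fa : f (x + a *: (y - x)) \is a fin_num
  by near: a; exact: (@ray_near _ _ _ _ [set z | f z \is a fin_num]).
have ga : g (x + a *: (y - x)) \is a fin_num.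
  by apply: domain_fin_num => //; exact: convex_domain_segment.
have f_le : (f (x + a *: (y - x))%R - f x
    <= a%:E * ((ip v (y - x)%R)%:E + e%:E))%E.
  by near: a; exact: gradient_upper_bound.
have g_le := convex_increment_le gcvx gx gy a01.
move: f_le g_le; rewrite /objective.
rewrite -(fineK fx) -(fineK fa) -(fineK gx) -(fineK ga) -(fineK gy).
rewrite -!(EFinD, EFinB, EFinM) !lee_fin; lra.
Unshelve. all: by end_near. Qed.

(** The model vanishes at the current iterate, so its infimum is nonpositive and
    so is the model at the candidate. A nonpositive model value forces g to be
    finite at the candidate, and bounds the linearized decrease by the quadratic
    term. *)
Lemma inexact_descent (R : realType) (H : completeNormedModType R)
    (ip : {dot H for idfun}) (g : H -> \bar R) (gradf : H -> H) (eta : R)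
    (Hk : {linear H -> H}) (x y : H) :
  Defs.proper g -> domain g x -> 0 <= eta -> inexact ip g gradf eta Hk x y ->
  domain g y /\
  ((ip (gradf x) (y - x)%R)%:E + (g y - g x)
     <= (- (2^-1 * metric_norm ip Hk (y - x) ^+ 2))%:E)%E.
Proof.
move=> gpr dx eta0; rewrite /inexact.
have gx := domain_fin_num gpr dx.
have model0 : model ip g gradf Hk x x = 0%E.
  rewrite /model subrr linear0r subee // /metric_norm linear0l.
  by rewrite sqrtr0 expr0n mulr0 !adde0.
have min_le0 : (model_min ip g gradf Hk x <= 0)%E.
  by rewrite -model0; apply: ereal_inf_lbound; exists x.
rewrite model0 sube0 => /le_trans/(_ (mule_ge0_le0 _ min_le0)).
rewrite lee_fin => /(_ eta0) model_le0.
have gyNoo : g y != -oo%E by case: gpr.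
have dy : domain g y.
  move: model_le0; rewrite /domain /model /= -(fineK gx).
  by case: (g y) => // r _; rewrite ltry.
split=> //; have gy := domain_fin_num gpr dy.
move: model_le0; rewrite /model -(fineK gx) -(fineK gy).
rewrite -!(EFinD, EFinB) !lee_fin; lra.
Qed.

Theorem lemma1 (R : realType) (H : completeNormedModType R)
    (ip : {dot H for idfun}) (hip : hilbert_norm ip)
    (f g : H -> \bar R) (gradf : H -> H)
    (hf : proper_lsc_convex f) (hg : proper_lsc_convex g)
    (hdom : domain g `<=` interior (domain f))
    (hgrad : exists U : set H, [/\ open U, domain g `<=` U &
               forall x, U x -> has_gradient ip f x (gradf x)])
    (hgradc : {within domain g, continuous gradf})
    (hX : minimizers (objective f g) !=set0)
    (hFstar : ereal_inf (range (objective f g)) \is a fin_num)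
    (Hk : nat -> {linear H -> H}) (m M : R)
    (hsa : forall k, self_adjoint ip (Hk k))
    (hpos : forall k, positive ip (Hk k))
    (hm : 0 < m) (hM : 0 < M)
    (hbounds : forall k x,
       m * `|x| ^+ 2 <= metric_norm ip (Hk k) x ^+ 2 <= M * `|x| ^+ 2)
    (eta : R) (heta : 0 < eta <= 1)
    (beta : R) (hbeta : 0 < beta < 1)
    (abar : R) (habar : 0 < abar <= 1)
    (k : nat) (xk : H) (hxk : domain (objective f g) xk)
    (xbar : H) (hxbar : inexact ip g gradf eta (Hk k) xk xbar) :
  [/\ forall gamma : R, 0 < gamma < 1 ->
        stepsize_exists abar beta (LS1 ip f g gradf gamma xk xbar),
      forall gamma : R, 0 < gamma < m / 2 ->
        stepsize_exists abar beta (LS2 gradf gamma xk xbar),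
      forall gamma : R, 0 < gamma < 1 ->
        stepsize_exists abar beta (LS3 ip f g gradf gamma (Hk k) xk xbar) &
      forall gamma : R, 0 < gamma < 1 ->
        stepsize_exists abar beta (LS4 ip f gradf gamma (Hk k) xk xbar)].
Proof.
have [gpr _ gcvx] := hg.
have [[fNoo _] _ _] := hf.
have gx : domain g xk.
  rewrite /domain /=; move: hxk (fNoo xk); rewrite /domain /objective /=.
  by case: (f xk) (g xk) => [r||] [s||] //; rewrite ?ltry ?ltNyr.
have fgrad : has_gradient ip f xk (gradf xk).
  by have [U [_ gU]] := hgrad; apply; exact: gU.
have /andP[eta0 _] := heta.
have /andP[abar0 _] := habar.
have [gy descent] := inexact_descent gpr gx (ltW eta0) hxbar.
have gxfin := domain_fin_num gpr gx.
have gyfin := domain_fin_num gpr gy.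
set d := xbar - xk in descent *.
set q := metric_norm ip (Hk k) d ^+ 2 in descent.
have q0 : 0 <= q by exact: sqr_ge0.
have dq : d != 0 -> 0 < q.
  move=> d0; have /andP[+ _] := hbounds k d; apply: lt_le_trans.
  by rewrite mulr_gt0 // exprn_gt0 // normr_gt0.
split=> gamma /andP[gamma0 gamma1]; apply: stepsize_exists_near => //.
- (* The slack turns the rate D of the upper bound into gamma * D. *)
  set D := ip (gradf xk) d + (fine (g xbar) - fine (g xk)).
  have DE : ((ip (gradf xk) d)%:E + (g xbar - g xk) = D%:E)%E.
    by rewrite -(fineK gxfin) -(fineK gyfin) -EFinB -EFinD.
  have Dq : D <= - (2^-1 * q) by rewrite -lee_fin -DE.
  have slack0 : 0 <= (1 - gamma) * - D by apply: mulr_ge0; lra.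
  have dslack : d != 0 -> 0 < (1 - gamma) * - D.
    by move=> /dq ?; apply: mulr_gt0; lra.
  have := objective_upper_bound fgrad gpr gcvx gx gy slack0 dslack.
  apply: filterS => a; rewrite /LS1 /= -/d DE => /le_trans; apply.
  by rewrite -EFinD -!EFinM lee_fin; lra.
- (* Convexity keeps the trial points in the domain of g, relative to which the
     gradient is continuous at the iterate. *)
  have [d0|d0] := eqVneq d 0.
    near=> a; rewrite /LS2 /= -/d d0 !scaler0 addr0 subrr normr0.
    by rewrite !mulr0.
  have gradf_near : \forall z \near xk, domain g z ->
      `|gradf z - gradf xk| <= gamma * `|d|.
    have /subspace_continuousP/(_ xk gx)/cvgr_distC_le := hgradc.
    by apply; rewrite mulr_gt0 // normr_gt0.
  near=> a.
  have /andP[a0 a1] : 0 < a <= 1 by near: a; exact: near_unit_steps.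
  rewrite /LS2 /= -/d normrZ gtr0_norm // mulrCA ler_pM2l //.
  have : domain g (xk + a *: d).
    by apply: convex_domain_segment => //; rewrite ltW.
  by near: a; exact: ray_near gradf_near.
- by apply: objective_upper_bound => // [|/dq ?];
    [apply: mulr_ge0|apply: mulr_gt0] => //; lra.
- by apply: gradient_upper_bound => // [|/dq ?];
    [apply: mulr_ge0|apply: mulr_gt0] => //; lra.
Unshelve. all: by end_near. Qed.
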